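(* Let $\vartheta_c\in(0,1)$ and $0<\tau\le\min\{\tau_{\mathrm{CFL},\Psi},\tau_{\mathrm{CFL,lf},c}(\vartheta_c)\}$. Let $(x_h^n)_{n\ge0}\subset\mathbb V_h$ be defined by $$\mathbf R_-x_h^{n+1}=\mathbf R_+x_h^n+\tau g_h^{n+1/2},\qquad n=0,1,2,\dots$$ with $x_h^0\in\mathbb V_h$ and $g_h^{n+1/2}\in\mathbb V_h$. Then for all $n\ge0$ $$\|x_h^{n+1}\|_\Omega\le C_{stb,c}\Bigl(\|x_h^0\|_{\mathbf\Theta_{\mathcal I}}+\tau\sum_{j=0}^n\|g_h^{j+1/2}\|_\Omega\Bigr),\qquad C_{stb,c}=\bigl(c_\Theta(1-\vartheta_c^2)\bigr)^{-1/2}.$$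
   Context: **Spaces.** $\Omega\subset\mathbb R^d$ is an open polygonal domain with mesh $\mathcal T_h$. $\mathbb V_h^u$, $\mathbb V_h^v$ are the spaces of (real) functions on $\Omega$ with $m_u$ resp. $m_v$ components that are on each $K\in\mathcal T_h$ polynomials of total degree at most $k$; $\mathbb V_h=\mathbb V_h^u\times\mathbb V_h^v$. $\mathcal M_u,\mathcal M_v\in L^\infty(\Omega)$ are symmetric, (uniformly) positive definite matrix-valued weights, $(u,\tilde u)_\Omega=\int_\Omega\mathcal M_uu\cdot\tilde u\,dx$, $(v,\tilde v)_\Omega=\int_\Omega\mathcal M_vv\cdot\tilde v\,dx$, these being added for pairs $(u,v)$; $\|\cdot\|_\Omega$ is the induced norm. **Discrete Friedrichs' operators.** $\mathcal L_{u,h}:\mathbb V_h^u\to\mathbb V_h^v$ and $\mathcal L_{v,h}:\mathbb V_h^v\to\mathbb V_h^u$ are linear (central-fluxes discontinuous Galerkin discretizations of a two-field Friedrichs' system) with $(\mathcal L_{u,h}u_h,v_h)_\Omega=-(u_h,\mathcal L_{v,h}v_h)_\Omega$ for all $u_h\in\mathbb V_h^u,v_h\in\mathbb V_h^v$. **Mesh splitting.** $\mathcal T_h=\mathcal T_{h,f}\dot\cup\mathcal T_{h,c}$; $\mathcal T_{h,m}$ consists of all elements of $\mathcal T_{h,f}$ and all elements sharing a face with an element of $\mathcal T_{h,f}$; $\mathcal T_{h,\mathrm{lf}}=\mathcal T_h\setminus\mathcal T_{h,m}$. $\chi_m,\chi_{\mathrm{lf}}$ are multiplication by the indicator functions of the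 unions of the elements of $\mathcal T_{h,m}$, $\mathcal T_{h,\mathrm{lf}}$. **Filter.** $\Psi:[0,\infty)\to\mathbb R$ is smooth, $\Psi(0)=1$, $\Theta(z)=\frac1{\Psi(z)}-\frac z4$. For $c_\Theta\in(0,1]$, $\beta_\Psi\in(0,\infty]$ is the maximum value such that $0<\Psi(z)\le1$ and $\Theta(z)\ge c_\Theta$ for all real $z\in[0,\beta_\Psi^2]$ ($\beta_\Psi=\infty$ if this holds for all $z\ge0$). Put $\mathbf\Psi=\Psi(-\tau^2\mathcal L_{v,h}\chi_m\mathcal L_{u,h})$ and $\mathbf\Theta=\Theta(-\tau^2\mathcal L_{v,h}\chi_m\mathcal L_{u,h})$ (functional calculus for a self-adjoint positive semidefinite operator). **CFL bounds.** $\tau_{\mathrm{CFL},\Psi}^2=\beta_\Psi^2/\|\mathcal L_{v,h}\chi_m\mathcal L_{u,h}\|$ and $\tau_{\mathrm{CFL,lf},c}^2(\vartheta_c)=4c_\Theta\vartheta_c^2/\|\mathcal L_{v,h}\chi_{\mathrm{lf}}\mathcal L_{u,h}\|$, with operator norms on $\mathbb V_h^u$ (no restriction when $\beta_\Psi=\infty$ or the denominator vanishes). **Operators of the scheme.** On $\mathbb V_h$, $$\mathbf R_\pm=\begin{pmatrix}\mathbf\Theta&\pm\frac\tau2\mathcal L_{v,h}\\ \pm\frac\tau2\mathcal L_{u,h}&\mathcal I_v\end{pmatrix}-\frac{\tau^2}{4}\begin{pmatrix}-\mathcal L_{v,h}\chi_{\mathrm{lf}}\mathcal L_{u,h}&0\\0&0\end{pmatrix},\qquad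 \mathbf\Theta_{\mathcal I}=\begin{pmatrix}\mathbf\Theta&0\\0&\mathcal I_v\end{pmatrix},$$ with $\mathcal I_v$ the identity on $\mathbb V_h^v$, and $\|x_h\|_{\mathbf\Theta_{\mathcal I}}^2=(\mathbf\Theta_{\mathcal I}x_h,x_h)_\Omega$, which is a norm on $\mathbb V_h$ under the stepsize restriction. (The recursion is the form taken by the local time-integration scheme $\overline v_h^{\,n+1/2}-v_h^n=\frac\tau2\mathcal L_{u,h}u_h^n+\frac\tau2g_{v,h}^{n+1/2}$, $u_h^{n+1}-u_h^n=\tau\mathbf\Psi(\mathcal L_{v,h}\overline v_h^{\,n+1/2}+g_{u,h}^{n+1/2})$, $v_h^{n+1}-\overline v_h^{\,n+1/2}=\frac\tau2\mathcal L_{u,h}u_h^{n+1}+\frac\tau2g_{v,h}^{n+1/2}$.) *)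

(* Defs.v *)
From HB Require Import structures.
From mathcomp Require Import all_boot all_order all_algebra.
From mathcomp Require Import all_classical all_reals all_analysis.
From mathcomp Require Import measurable_realfun.

Set Implicit Arguments.
Unset Strict Implicit.
Unset Printing Implicit Defensive.
Import Order.TTheory GRing.Theory Num.Theory.
Import numFieldNormedType.Exports.
Local Open Scope classical_set_scope.
Local Open Scope ring_scope.

(* 'rV[R]_n is equipped with its Borel sigma-algebra. *)
HB.instance Definition _ (R : realType) (n : nat) :=
  @isMeasurable.Build (sigma_display (@open 'rV[R]_n)) 'rV[R]_n
    <<s @open 'rV[R]_n >>
    (@sigma_algebra0 _ setT _) (@sigma_algebraC _ _)
    (@sigma_algebra_bigcup _ setT _).

Lemma open_measurable_rV (R : realType) (n : nat) (U : set 'rV[R]_n) :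
  open U -> measurable U.
Proof. exact: sub_sigma_algebra. Qed.

Lemma measurable_coord_rV (R : realType) (n : nat) (i : 'I_n) :
  measurable_fun setT (fun x : 'rV[R]_n => x ord0 i).
Proof.
apply: (measurability _ (RGenOpens.measurableE R)).
move=> _ [_ [a [b ->] <-]]; rewrite setTI; apply: open_measurable_rV.
apply: open_comp; last exact: interval_open.
by move=> x _; exact: coord_continuous.
Qed.

(* An open set is the union of the countably many rational cubes it contains. *)
Lemma measurable_fun_rV d (T : measurableType d) (R : realType) (n : nat)
    (f : T -> 'rV[R]_n) :
  (forall i, measurable_fun setT (fun t => f t ord0 i)) ->
  measurable_fun setT f.
Proof.
move=> mf; apply: (measurability (@open 'rV[R]_n)) => // _ [U oU <-].
rewrite setTI.
pose q (c : 'rV[rat]_n) : 'rV[R]_n := map_mx ratr c.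
pose cube (p : 'rV[rat]_n * nat) := ball (q p.1) (p.2.+1%:R^-1 : R).
have -> : f @^-1` U = \bigcup_(p in [set p | cube p `<=` U]) (f @^-1` cube p).
  rewrite eqEsubset; split=> [t Ut|t [p /= pU] tp]; last exact: pU.
  have /nbhs_ballP[e /= e0 eU] := open_nbhs_nbhs (conj oU Ut).
  have [N /= Ne] : exists N : nat, N.+1%:R^-1 < e / 2.
    have e20 : 0 < e / 2 by rewrite divr_gt0.
    have [N _ /(_ N (leqnn N)) NN] := near_infty_natSinv_lt (PosNum e20).
    by exists N.
  have N0 : 0 < N.+1%:R^-1 :> R by rewrite invr_gt0.
  have /choice[c cP] (i : 'I_n) : exists c : rat,
      ball (f t ord0 i) (N.+1%:R^-1 : R) (ratr c).
    have B0 : ball (f t ord0 i) (N.+1%:R^-1 : R) !=set0.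
      by exists (f t ord0 i); exact: ballxx.
    have [r [Br [c _ cr]]] := dense_rat B0 (ball_open _ _).
    by exists c; rewrite cr.
  have cf : cube (\row_i c i, N) (f t).
    split => // i j; apply: ball_sym; rewrite /q !mxE ord1.
    exact: cP.
  exists (\row_i c i, N) => //= y cy; apply: eU.
  rewrite (splitr e); apply: (@ball_triangle _ _ (q (\row_i c i))).
    by apply: ball_sym; apply: le_ball cf; exact: ltW.
  by apply: le_ball cy; exact: ltW.
rewrite bigcup_mkcond; apply: countable_bigcupT_measurable => // -[c N].
case: ifPn => // _.
have -> : f @^-1` cube (c, N) = \big[setI/setT]_(i < n)
    ((fun t => f t ord0 i) @^-1` ball (q c ord0 i) (N.+1%:R^-1 : R)).
  rewrite eqEsubset; split=> [t [_ ct]|t ct].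
    by apply: (big_ind (fun A : set T => A t)) => // i _; exact: ct.
  split=> [|i j]; first by rewrite invr_gt0.
  by rewrite (ord1 i); move: ct; rewrite (bigD1 j) => [[]|].
apply: bigsetI_measurable => i _; rewrite -[X in measurable X]setTI.
by apply: mf => //; apply: open_measurable; exact: ball_open.
Qed.

Section lebesgue_measure_rV.
Variable R : realType.

Definition cons_rV (n : nat) (p : 'rV[R]_n * R) : 'rV[R]_n.+1 :=
  row_mx (p.2%:M : 'rV_1) p.1.

Lemma measurable_cons_rV n : measurable_fun setT (@cons_rV n).
Proof.
apply: measurable_fun_rV => i; rewrite /cons_rV.
have [j ->|j ->] := split_ordP (i : 'I_(1 + n)).
  rewrite (_ : (fun _ => _) = snd); first exact: measurable_snd.
  apply/funext => p; apply: etrans (row_mxEl _ _ ord0 j) _.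
  by rewrite mxE !ord1 eqxx mulr1n.
rewrite (_ : (fun _ => _) = (fun x : 'rV[R]_n => x ord0 j) \o fst).
  exact: measurableT_comp (measurable_coord_rV j) measurable_fst.
by apply/funext => p; exact: row_mxEr.
Qed.

Section lebesgue_cons.
Variables (n : nat) (m : {measure set 'rV[R]_n -> \bar R}).

Definition lebesgue_cons : set 'rV[R]_n.+1 -> \bar R :=
  pushforward (m \x (@lebesgue_measure R))%E (@cons_rV n).

Let lebesgue_cons0 : lebesgue_cons set0 = 0%E.
Proof. by rewrite /lebesgue_cons /pushforward preimage_set0 measure0. Qed.

Let lebesgue_cons_ge0 A : (0 <= lebesgue_cons A)%E.
Proof. by apply: integral_ge0 => x _; exact: measure_ge0. Qed.

Let lebesgue_cons_sigma_additive : semi_sigma_additive lebesgue_cons.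
Proof.
pose mf := @measurable_cons_rV n.
move=> F mF tF mUF; rewrite /lebesgue_cons /pushforward preimage_bigcup.
apply: measure_semi_sigma_additive.
- by move=> i; rewrite -[X in measurable X]setTI; exact: mf.
- apply/trivIsetP => /= i j _ _ ij; rewrite -preimage_setI.
  by move/trivIsetP : tF => /(_ _ _ _ _ ij) ->//; rewrite preimage_set0.
- by rewrite -preimage_bigcup -[X in measurable X]setTI; exact: mf.
Qed.

HB.instance Definition _ := isMeasure.Build _ _ _ lebesgue_cons
  lebesgue_cons0 lebesgue_cons_ge0 lebesgue_cons_sigma_additive.

End lebesgue_cons.

Fixpoint lebesgue_rV (n : nat) : {measure set 'rV[R]_n -> \bar R} :=
  match n with
  | 0 => \d_ (0 : 'rV[R]_0)
  | n'.+1 => lebesgue_cons (lebesgue_rV n')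
  end.

Lemma lebesgue_rV_box n (A : 'I_n -> set R) :
  (forall i, measurable (A i)) ->
  lebesgue_rV n [set x | forall i, A i (x ord0 i)] =
  (\prod_(i < n) lebesgue_measure (A i))%E.
Proof.
elim: n A => [|n IHn] A mA.
  by rewrite big_ord0 /= diracE mem_set//= => -[].
rewrite big_ord_recl /= /lebesgue_cons /pushforward.
have -> : @cons_rV n @^-1` [set x | forall i, A i (x ord0 i)] =
    [set x : 'rV[R]_n | forall i : 'I_n, A (lift ord0 i) (x ord0 i)] `*` A ord0.
  have E0 p : @cons_rV n p ord0 ord0 = p.2.
    rewrite (_ : ord0 = lshift n (ord0 : 'I_1) :> 'I_(1 + n)); last exact: val_inj.
    by apply: etrans (row_mxEl _ _ ord0 ord0) _; rewrite mxE.
  have ES p i : @cons_rV n p ord0 (lift ord0 i) = p.1 ord0 i.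
    rewrite (_ : lift ord0 i = rshift 1 i :> 'I_(1 + n)); last exact: val_inj.
    exact: row_mxEr.
  rewrite eqEsubset; split=> p /= => [Ap|[Ap1 Ap2] i].
    by split=> [i|]; [rewrite -ES|rewrite -E0].
  by case: (unliftP ord0 i) => [j ->|->]; rewrite ?ES ?E0.
have mB : measurable
    [set x : 'rV[R]_n | forall i : 'I_n, A (lift ord0 i) (x ord0 i)].
  rewrite (_ : mkset _ = \big[setI/setT]_(i < n)
      ((fun x : 'rV[R]_n => x ord0 i) @^-1` A (lift ord0 i))).
    apply: bigsetI_measurable => i _; rewrite -[X in measurable X]setTI.
    exact: measurable_coord_rV.
  rewrite eqEsubset; split=> [t ct|t ct j].
    by apply: (big_ind (fun B : set 'rV[R]_n => B t)) => // i _; exact: ct.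
  by move: ct; rewrite (bigD1 j) => [[]|].
rewrite product_measure1E; [|exact: mB|exact: mA]; rewrite muleC; congr (_ * _)%E.
by apply: (IHn (fun i => A (lift ord0 i))) => i; exact: mA.
Qed.

End lebesgue_measure_rV.

Section polytopes.
Variables (R : realType) (d : nat).
Implicit Types U V : set 'rV[R]_d.

Definition dotr (a x : 'rV[R]_d) : R := \sum_(i < d) a ord0 i * x ord0 i.

Definition hyperplane (a : 'rV[R]_d) (b : R) : set 'rV[R]_d :=
  [set x | dotr a x = b].

(* Nonempty bounded open connected sets, not necessarily convex, whose boundary
   lies in finitely many hyperplanes. *)
Definition polytopal U : Prop :=
  [/\ open U, U !=set0, connected U, bounded_set U &
      exists2 H : seq ('rV[R]_d * R), (forall p, p \in H -> p.1 != 0) &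
        closure U `\` U `<=` [set x | exists2 p, p \in H & hyperplane p.1 p.2 x]].

Definition is_mesh (Omega : set 'rV[R]_d) (N : nat)
    (K : 'I_N -> set 'rV[R]_d) : Prop :=
  [/\ forall i, polytopal (K i),
      forall i, K i `<=` Omega,
      forall i j, i != j -> K i `&` K j = set0 &
      closure Omega = \bigcup_i closure (K i)].

(* The closures meet in a (d-1)-dimensional set: they share a relatively open
   piece of a hyperplane. Meshes need not be matching. *)
Definition share_face U V : Prop :=
  exists (a x : 'rV[R]_d) (e : R),
    [/\ a != 0, 0 < e &
        ball x e `&` hyperplane a (dotr a x) `<=` closure U `&` closure V].

Definition mesh_m (N : nat) (K : 'I_N -> set 'rV[R]_d) (Tf : {set 'I_N}) :
    {set 'I_N} :=
  Tf :|: [set i | `[< exists2 j, j \in Tf & share_face (K i) (K j) >]]%SET.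

Definition mesh_lf (N : nat) (K : 'I_N -> set 'rV[R]_d) (Tf : {set 'I_N}) :
    {set 'I_N} :=
  (~: mesh_m K Tf)%SET.

End polytopes.

Section broken_polynomials.
Variables (R : realType) (d N : nat).
Implicit Types m k : nat.

(* Exponents of the monomials of total degree at most k in d variables. *)
Definition expo k := {a : {ffun 'I_d -> 'I_k.+1} | (\sum_i a i <= k)%N}.

(* The coefficients of the m polynomials given on each of the N elements. *)
Definition Vh m k := {ffun 'I_N -> {ffun 'I_m -> {ffun expo k -> R^o}}}.

Definition peval k (p : {ffun expo k -> R^o}) (x : 'rV[R]_d) : R :=
  \sum_(a : expo k) p a * \prod_(i < d) x ord0 i ^+ (val a i).

(* The function on Omega, extended by 0 off the union of the open elements. *)
Definition fun_of m k (K : 'I_N -> set 'rV[R]_d) (u : Vh m k) (x : 'rV[R]_d) :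
    'cV[R]_m :=
  \sum_(i < N) (\1_(K i) x : R) *: \col_j peval (u i j) x.

Definition chi m k (S : {set 'I_N}) (u : Vh m k) : Vh m k :=
  [ffun i => if i \in S then u i else 0].

Lemma fun_of_chi m k (K : 'I_N -> set 'rV[R]_d) (S : {set 'I_N}) (u : Vh m k) x :
  (forall i j, i != j -> K i `&` K j = set0) ->
  fun_of K (chi S u) x =
  (\1_(\bigcup_(i in [set i | i \in S]) K i) x : R) *: fun_of K u x.
Proof.
move=> tK.
have K0 i j : K i x -> j != i -> \1_(K j) x = 0 :> R.
  move=> Kix ji; rewrite indicE memNset// => Kjx.
  by have : (K j `&` K i) x by []; rewrite tK.
have [[i Kix]|nK] := pselect (exists i, K i x).
  rewrite /fun_of (bigD1 i) //= [in RHS](bigD1 i) //=.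
  rewrite !big1 ?addr0; try by move=> j ji; rewrite (K0 i) // scale0r.
  rewrite !indicE (mem_set Kix) ffunE !scale1r.
  case: ifPn => iS.
    rewrite mem_set ?scale1r//; exists i => //.
  rewrite memNset ?scale0r; last first.
    move=> [j /= jS Kjx]; have [ij|ij] := eqVneq i j; first by rewrite ij jS in iS.
    by have : (K i `&` K j) x by []; rewrite tK.
  apply/colP => j; rewrite !mxE /peval big1 // => a _.
  by rewrite !ffunE mul0r.
rewrite indicE memNset ?scale0r; last by move=> [i _ Kix]; apply: nK; exists i.
rewrite /fun_of big1 // => i _; rewrite indicE memNset ?scale0r// => Kix.
by apply: nK; exists i.
Qed.

End broken_polynomials.

Section weighted_inner_product.
Variables (R : realType) (d N : nat) (Omega : set 'rV[R]_d).
Variable (K : 'I_N -> set 'rV[R]_d).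
Implicit Types m k : nat.

Definition dotc m (a b : 'cV[R]_m) : R := \sum_(i < m) a i ord0 * b i ord0.

Definition is_weight m (M : 'rV[R]_d -> 'M[R]_m) : Prop :=
  [/\ forall i j, measurable_fun Omega (fun x => M x i j),
      exists C : R, {ae lebesgue_rV R d, forall x, Omega x ->
        forall i j, `|M x i j| <= C},
      {ae lebesgue_rV R d, forall x, Omega x -> (M x)^T = M x} &
      exists2 c : R, 0 < c & {ae lebesgue_rV R d, forall x, Omega x ->
        forall xi, c * dotc xi xi <= dotc (M x *m xi) xi}].

Definition ip m k (M : 'rV[R]_d -> 'M[R]_m) (u w : Vh R d N m k) : R :=
  \int[lebesgue_rV R d]_(x in Omega)
    dotc (M x *m fun_of K u x) (fun_of K w x).

Definition ip2 mu mv k (Mu : 'rV[R]_d -> 'M[R]_mu) (Mv : 'rV[R]_d -> 'M[R]_mv)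
    (x y : Vh R d N mu k * Vh R d N mv k) : R :=
  ip Mu x.1 y.1 + ip Mv x.2 y.2.

End weighted_inner_product.

(* For V finite-dimensional with inner product dot, the supremum is that of a
   bounded set. *)
Definition opnorm (R : realType) (V : lmodType R) (dot : V -> V -> R)
    (T : V -> V) : R :=
  sup [set Num.sqrt (dot (T u) (T u)) | u in [set u | dot u u <= 1]].

(* B = f(T). For T self-adjoint, hence diagonalizable, a linear B is determined
   by its values on the eigenvectors of T. *)
Definition is_funcalc (R : realType) (V : lmodType R) (f : R -> R) (T : V -> V)
    (B : {linear V -> V}) : Prop :=
  forall (lambda : R) (w : V), T w = lambda *: w -> B w = f lambda *: w.

Section filter.
Variable R : realType.
Implicit Types (Psi : R -> R) (cTheta : R) (b beta : \bar R).

(* Psi is smooth on [0, +oo[, i.e. it extends there to a smooth function. *)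
Definition smooth_nonneg Psi : Prop :=
  exists2 F : R -> R, (forall n x, derivable (derive1n n F) x 1) &
    forall z, 0 <= z -> F z = Psi z.

Definition Theta Psi (z : R) : R := (Psi z)^-1 - z / 4.

Definition filter_bounds Psi cTheta b : Prop :=
  forall z : R, 0 <= z -> (z%:E <= b ^+ 2)%E ->
    [/\ 0 < Psi z, Psi z <= 1 & cTheta <= Theta Psi z].

Definition is_betaPsi Psi cTheta beta : Prop :=
  [/\ (0 < beta)%E, filter_bounds Psi cTheta beta &
      forall b, (0 < b)%E -> filter_bounds Psi cTheta b -> (b <= beta)%E].

Definition tau_CFL_Psi beta (nrm : R) : \bar R :=
  if nrm == 0 then +oo%E else sqrte (beta ^+ 2 * (nrm^-1)%:E)%E.

Definition tau_CFL_lf cTheta (vartheta nrm : R) : \bar R :=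
  if nrm == 0 then +oo%E else (Num.sqrt (4 * cTheta * vartheta ^+ 2 / nrm))%:E.

End filter.

Section scheme.
Variables (R : realType) (U V : lmodType R).
Variables (Lu : U -> V) (Lv : V -> U) (chilf : V -> V) (ThetaT : U -> U).

(* R_+ for s = 1 and R_- for s = -1 *)
Definition Rop (s tau : R) (x : U * V) : U * V :=
  (ThetaT x.1 + (s * (tau / 2)) *: Lv x.2
     - (tau ^+ 2 / 4) *: (- Lv (chilf (Lu x.1))),
   (s * (tau / 2)) *: Lu x.1 + x.2).

Definition ThetaI (x : U * V) : U * V := (ThetaT x.1, x.2).

End scheme.

(* Main.v *)
Require Import Defs.
From HB Require Import structures.
From mathcomp Require Import all_boot all_order all_algebra.
From mathcomp Require Import complex ring lra.
From mathcomp Require Import all_classical all_reals all_analysis.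
From mathcomp Require Import measurable_realfun.
Import Order.TTheory GRing.Theory Num.Theory.
Import numFieldNormedType.Exports.
Local Open Scope classical_set_scope.
Local Open Scope ring_scope.

(** Let D be the diagonal operator diag(Theta - (tau^2/4) A, 1) with
    A = - Lv chi_lf Lu, and S the off-diagonal part (tau/2) (Lv, Lu).  Since
    Lv is minus the adjoint of Lu, S is skew-adjoint, and R_+ = D + S,
    R_- = D - S.  The form (D x, y) is the energy of the scheme.

    - The energy is an inner product.  With B = - Lv chi_m Lu, the eigenvalues
      of tau^2 B lie in [0, beta_Psi^2] by the first stepsize restriction, so
      Theta >= c_Theta (filter_quadratic); the second one gives
      (tau^2/4) (A u, u) <= c_Theta vartheta_c^2 |u|^2.  Hence
      (D x, x) >= c_Theta (1 - vartheta_c^2) |x|^2.  As A >= 0, the energy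
      is also at most the squared Theta_I-norm.
    - If R_- w = R_+ x, pairing D (w - x) = S (w + x) with w + x shows that
      w and x have the same energy (Rm_Rp_energy).
    - If R_- z = g, then (D z, z) <= |g|^2 (Rm_energy).  Pairing with z and
      Cauchy-Schwarz would lose a factor C_stb here.  Eliminating the second
      component instead leaves the operator Theta + (tau^2/4) B; because
      Theta(z) + z/4 = 1/Psi(z) this is the inverse of the filter, which is
      >= 1, and
      (D z, z) = 2 (g_u, u) + |g_v|^2 - (Psi^-1 u, u)
               <= 2 (g_u, u) - |u|^2 + |g_v|^2 <= |g_u|^2 + |g_v|^2.
      The same lower bound makes R_- surjective (Rm_surj).

    Splitting each step into a homogeneous and a forced part, the energy norm
    grows by at most tau |g| per step (scheme_energy_step), and coercivity is
    used once, at the end: this is why C_stb appears only to the first power.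

    The functional calculus is only specified on eigenvectors, so these bounds
    rest on the spectral theorem for self-adjoint operators (spectral).  It
    requires the weighted L^2 product of broken polynomials to be definite
    (ip_definite): a function of zero norm vanishes almost everywhere, hence
    on each open element, and a polynomial vanishing on a nonempty open set
    has zero coefficients (peval_eq0_open, peval_inj). *)

Set Implicit Arguments.
Unset Strict Implicit.
Unset Printing Implicit Defensive.

(** * Semi-inner products *)

(** Definiteness is a separate hypothesis, made where eigenvectors have to be
    normalized or operators inverted. *)
Record semi_inner (R : numDomainType) (V : lmodType R) (dot : V -> V -> R) :
    Prop := SemiInner {
  inner_sym : forall u v, dot u v = dot v u;
  inner_linear : forall a u v w, dot (a *: u + v) w = a * dot u w + dot v w;
  inner_ge0 : forall u, 0 <= dot u u }.

Section semi_inner_theory.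
Variables (R : rcfType) (V : lmodType R) (dot : V -> V -> R).
Hypothesis dotP : semi_inner dot.

Lemma innerDl u v w : dot (u + v) w = dot u w + dot v w.
Proof. by rewrite -[u]scale1r (inner_linear dotP) mul1r !scale1r. Qed.

Lemma inner0l w : dot 0 w = 0.
Proof. by apply/(addrI (dot 0 w)); rewrite -innerDl !addr0. Qed.

Lemma innerZl a u w : dot (a *: u) w = a * dot u w.
Proof. by rewrite -[a *: u]addr0 (inner_linear dotP) inner0l addr0. Qed.

Lemma innerNl u w : dot (- u) w = - dot u w.
Proof. by rewrite -scaleN1r innerZl mulN1r. Qed.

Lemma innerDr u v w : dot w (u + v) = dot w u + dot w v.
Proof. by rewrite !(inner_sym dotP w) innerDl. Qed.

Lemma innerZr a u w : dot w (a *: u) = a * dot w u.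
Proof. by rewrite !(inner_sym dotP w) innerZl. Qed.

Lemma innerNr u w : dot w (- u) = - dot w u.
Proof. by rewrite !(inner_sym dotP w) innerNl. Qed.

Lemma inner0r w : dot w 0 = 0.
Proof. by rewrite (inner_sym dotP) inner0l. Qed.

Lemma inner_sumr (I : Type) (r : seq I) (F : I -> V) w :
  dot w (\sum_(i <- r) F i) = \sum_(i <- r) dot w (F i).
Proof. by apply: (big_morph (dot w) (fun u v => innerDr u v w) (inner0r w)). Qed.

Definition inner_norm u := Num.sqrt (dot u u).

Lemma inner_norm_ge0 u : 0 <= inner_norm u.
Proof. exact: sqrtr_ge0. Qed.

Lemma sqr_inner_norm u : inner_norm u ^+ 2 = dot u u.
Proof. by rewrite sqr_sqrtr ?(inner_ge0 dotP). Qed.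

(** Minimize dot (u + t v) (u + t v) over t; when dot v v = 0 this quadratic
    is affine in t, and a large t rules out dot u v <> 0. *)
Lemma CauchySchwarz_sqr u v : dot u v ^+ 2 <= dot u u * dot v v.
Proof.
have H t : 0 <= dot u u + 2 * t * dot u v + t ^+ 2 * dot v v.
  have := inner_ge0 dotP (u + t *: v).
  rewrite !(innerDl, innerDr, innerZl, innerZr) (inner_sym dotP v u).
  by move=> h; lra.
have [v0|v0] := eqVneq (dot v v) 0.
  rewrite v0 mulr0; have [->|uv0] := eqVneq (dot u v) 0; first by rewrite expr0n.
  have := H (- (dot u u + 1) / (2 * dot u v)); rewrite v0 mulr0 addr0.
  suff -> : dot u u + 2 * (- (dot u u + 1) / (2 * dot u v)) * dot u v = -1.
    by rewrite lerNr oppr0 ler10.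
  by field.
have vp : 0 < dot v v by rewrite lt0r v0 (inner_ge0 dotP).
have := H (- dot u v / dot v v).
have -> : dot u u + 2 * (- dot u v / dot v v) * dot u v +
  (- dot u v / dot v v) ^+ 2 * dot v v = dot u u - dot u v ^+ 2 / dot v v.
  by field.
by rewrite subr_ge0 ler_pdivrMr.
Qed.

Lemma inner_normD u v : inner_norm (u + v) <= inner_norm u + inner_norm v.
Proof.
rewrite -(@ler_pXn2r _ 2) ?nnegrE ?addr_ge0 ?inner_norm_ge0 //.
rewrite sqrrD !sqr_inner_norm innerDl !innerDr (inner_sym dotP v u).
suff : dot u v <= inner_norm u * inner_norm v by rewrite mulr2n; lra.
apply: le_trans (ler_norm _) _.
rewrite -(@ler_pXn2r _ 2) ?nnegrE ?mulr_ge0 ?inner_norm_ge0 //.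
by rewrite exprMn !sqr_inner_norm real_normK ?num_real // CauchySchwarz_sqr.
Qed.

End semi_inner_theory.

(** * Self-adjoint operators in finite dimension *)

Section spectral.
Variable R : rcfType.

Import VectorInternalTheory.

(** The matrix of T has a complex eigenvector x + i y, with eigenvalue a + i b.
    Then T x = a x - b y and T y = b x + a y, and dot (T x) y = dot x (T y)
    reads b (|x|^2 + |y|^2) = 0, so x or y is an eigenvector for a. *)
Lemma ex_eigenvector (V : vectType R) (dot : V -> V -> R) (T : {linear V -> V}) :
  semi_inner dot -> (forall u, dot u u = 0 -> u = 0) ->
  (forall u v, dot (T u) v = dot u (T v)) ->
  (exists u : V, u != 0) ->
  exists mu : R, exists2 u : V, u != 0 & T u = mu *: u.
Proof.
move=> dotP dot0 Tsym [u0 u0N0].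
pose n := dim V.
pose rv : {linear 'rV[R]_n -> V} := GRing.Linear.clone _ _ _ _ (@r2v R V) _.
pose M : 'M[R]_n := \matrix_i v2r (T (rv (delta_mx 0 i))).
have n0 : (0 < n)%N.
  rewrite lt0n; apply: contra u0N0 => /eqP n0.
  rewrite -(v2rK u0) (_ : v2r u0 = 0) ?linear0 //.
  by apply/rowP => -[j jn]; exfalso; move: jn; rewrite -/n n0.
have ME x : rv (x *m M) = T (rv x).
  rewrite mulmx_sum_row [in RHS](row_sum_delta x) !linear_sum.
  by apply: eq_bigr => i _; rewrite !linearZ /= rowK /rv /= v2rK.
pose f := real_complex R.
have [[a b]] := eigenvalue_closed (map_mx f M) n0.
move=> /eigenvalueP[w wM w0].
pose x := rv (map_mx (@complex.Re R) w); pose y := rv (map_mx (@complex.Im R) w).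
have wE : w = map_mx f (map_mx (@complex.Re R) w) +
    'i%C *: map_mx f (map_mx (@complex.Im R) w).
  by apply/rowP => i; rewrite !mxE -complexE.
have Tx : T x = a *: x - b *: y.
  rewrite -ME -!linearZ -linearB; congr (rv _); apply/rowP => j.
  have /rowP/(_ j)/(congr1 (@complex.Re R)) := wM.
  rewrite !mxE => /= H; transitivity (complex.Re (\sum_i w 0 i * map_mx f M i j)).
    rewrite raddf_sum; apply: eq_bigr => i _; rewrite !mxE /f.
    by case: (w 0 i) => p q /=; rewrite mulr0 subr0.
  by rewrite H; case: (w 0 j).
have Ty : T y = b *: x + a *: y.
  rewrite -ME -!linearZ -linearD; congr (rv _); apply/rowP => j.
  have /rowP/(_ j)/(congr1 (@complex.Im R)) := wM.
  rewrite !mxE => /= H; transitivity (complex.Im (\sum_i w 0 i * map_mx f M i j)).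
    rewrite raddf_sum; apply: eq_bigr => i _; rewrite !mxE /f.
    by case: (w 0 i) => p q /=; rewrite mulr0 add0r.
  by rewrite H; case: (w 0 j) => p q /=; rewrite addrC.
have b0 : b * (dot x x + dot y y) = 0.
  have := Tsym x y; rewrite Tx Ty.
  rewrite !(innerDl dotP, innerDr dotP, innerZl dotP, innerZr dotP, innerNl dotP).
  by move=> H; rewrite mulrDr; lra.
have [x0|x0] := eqVneq x 0; last first.
  exists a, x => //; rewrite Tx; move/eqP: b0; rewrite mulf_eq0 => /orP[/eqP->|].
    by rewrite scale0r subr0.
  rewrite paddr_eq0 ?(inner_ge0 dotP) // => /andP[/eqP/dot0 xx _].
  by rewrite xx eqxx in x0.
have y0 : y != 0.
  apply: contra w0 => /eqP y0.
  have /(congr1 v2r) := x0; have /(congr1 v2r) := y0.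
  rewrite /x /y /rv /= !r2vK !linear0 => yE xE.
  rewrite wE yE xE; apply/eqP/rowP => j.
  by rewrite !mxE (_ : f 0 = 0) // mulr0 addr0.
by exists a, y => //; rewrite Ty x0 scaler0 add0r.
Qed.

(** The entries of s are pairs (eigenvalue, unit eigenvector).  For unit
    vectors, the expansion of every vector amounts to being an orthonormal
    basis, and it is what sums over the spectrum use.  An eigenvector f of T in an
    invariant subspace W leaves the smaller invariant subspace of the vectors
    of W orthogonal to f, whence an induction on the dimension. *)
Theorem spectral (V : vectType R) (dot : V -> V -> R) (T : {linear V -> V}) :
  semi_inner dot -> (forall u, dot u u = 0 -> u = 0) ->
  (forall u v, dot (T u) v = dot u (T v)) ->
  exists s : seq (R * V),
    (forall p, p \in s -> T p.2 = p.1 *: p.2 /\ dot p.2 p.2 = 1) /\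
    forall u, u = \sum_(p <- s) dot u p.2 *: p.2.
Proof.
move=> dotP dot0 Tsym.
suff H m (W : {vspace V}) : (\dim W <= m)%N ->
    (forall u, u \in W -> T u \in W) ->
    exists s : seq (R * V),
      (forall p, p \in s ->
        [/\ p.2 \in W, T p.2 = p.1 *: p.2 & dot p.2 p.2 = 1]) /\
      forall u, u \in W -> u = \sum_(p <- s) dot u p.2 *: p.2.
  have [|s [s1 s2]] := H _ fullv (leqnn _); first by move=> *; exact: memvf.
  by exists s; split=> [p /s1[]|u] //; apply: s2; exact: memvf.
elim: m W => [|m IH] W dW TW.
  exists [::]; split=> // u uW; rewrite big_nil; apply/eqP.
  by move: uW; move: dW; rewrite leqn0 dimv_eq0 => /eqP ->; rewrite memv0.
have [W0|W0] := eqVneq W 0%VS.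
  by apply: IH => //; rewrite W0 dimv0.
(* T maps W to itself, so that it restricts to the space subvs_of W. *)
have [mu [e eW [e0 Te]]] : exists mu : R, exists2 e : V, e \in W &
    e != 0 /\ T e = mu *: e.
  pose dW' (u v : subvs_of W) := dot (vsval u) (vsval v).
  pose TW' (u : subvs_of W) := vsproj W (T (vsval u)).
  have TW'l : linear TW' by move=> a u v; rewrite /TW' !linearP.
  pose TWL := GRing.isLinear.Build _ _ _ _ TW' TW'l.
  pose TL : {linear subvs_of W -> subvs_of W} := HB.pack TW' TWL.
  have [] := @ex_eigenvector _ dW' TL.
  - split=> [u v|a u v w|u]; rewrite /dW'.
    + exact: (inner_sym dotP).
    + by rewrite linearP (inner_linear dotP).
    + exact: (inner_ge0 dotP).
  - by move=> u /dot0 H; apply: val_inj.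
  - move=> u v; rewrite /dW' /= /TW' !vsprojK ?Tsym //; apply: TW; exact: subvsP.
  - exists (vsproj W (vpick W)); rewrite -(inj_eq val_inj) /= vsprojK ?memv_pick //.
    by rewrite vpick0.
  - move=> mu [u u0 Tu]; exists mu; exists (vsval u); first exact: subvsP.
    split; first by rewrite (inj_eq val_inj u 0).
    suff <- : vsval (TL u) = T (vsval u) by rewrite Tu.
    by rewrite /= /TW' vsprojK //; apply: TW; exact: subvsP.
have ee : 0 < dot e e.
  rewrite lt0r (inner_ge0 dotP) andbT; apply: contra e0 => /eqP/dot0 ->//.
pose f := (Num.sqrt (dot e e))^-1 *: e.
have fW : f \in W by exact: memvZ.
have ff : dot f f = 1.
  rewrite /f (innerZl dotP) (innerZr dotP) mulrA -expr2 exprVn sqr_sqrtr ?(ltW ee) //.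
  by rewrite mulVf // gt_eqF.
have Tf : T f = mu *: f by rewrite /f linearZ /= Te !scalerA [mu * _]mulrC.
pose phi u : R^o := dot u f.
have phil : linear phi by move=> a u v; exact: (inner_linear dotP).
pose phiL := GRing.isLinear.Build _ _ _ _ phi phil.
pose phL : {linear V -> R^o} := HB.pack phi phiL.
pose W' := (W :&: lker (linfun phL))%VS.
have W'E u : (u \in W') = (u \in W) && (dot u f == 0).
  by rewrite memv_cap memv_ker lfunE.
have fW' : f \notin W' by rewrite W'E fW ff oner_eq0.
have [||s [s1 s2]] := IH W'.
- rewrite -ltnS; apply: leq_trans dW; rewrite ltn_neqAle dimvS ?capvSl // andbT.
  apply: contra fW' => /eqP dE.
  suff -> : W' = W by [].
  by apply/eqP; rewrite eqEdim capvSl dE /=.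
- move=> u; rewrite !W'E => /andP[uW /eqP u0]; rewrite TW //= Tsym Tf (innerZr dotP).
  by rewrite u0 mulr0.
exists ((mu, f) :: s); split.
  move=> p; rewrite inE => /orP[/eqP->//|/s1[]].
  by rewrite W'E => /andP[].
move=> u uW; rewrite big_cons /=.
have uW' : u - dot u f *: f \in W'.
  rewrite W'E rpredB ?rpredZ //= (innerDl dotP) (innerNl dotP) (innerZl dotP).
  by rewrite ff mulr1 subrr.
rewrite -[LHS](subrK (dot u f *: f)) addrC; congr (_ + _).
rewrite [LHS](s2 _ uW') big_seq [RHS]big_seq; apply: eq_bigr => p /s1[].
rewrite W'E => /andP[_ /eqP pf] _ _.
rewrite (innerDl dotP) (innerNl dotP) (innerZl dotP) (inner_sym dotP f) pf.
by rewrite mulr0 subr0.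
Qed.

End spectral.

Section eigenbasis.
Variables (R : realType) (V : vectType R) (dot : V -> V -> R).
Variables (T : V -> V) (s : seq (R * V)).
Hypothesis dotP : semi_inner dot.
Hypothesis s_eigen : forall p, p \in s -> T p.2 = p.1 *: p.2 /\ dot p.2 p.2 = 1.
Hypothesis s_full : forall u, u = \sum_(p <- s) dot u p.2 *: p.2.

Lemma eigenbasis_dot u w : dot u w = \sum_(p <- s) dot u p.2 * dot w p.2.
Proof.
rewrite {1}(s_full w) (inner_sumr dotP); apply: eq_bigr => p _.
by rewrite (innerZr dotP) mulrC.
Qed.

Lemma eigenbasis_dot_funcalc (f : R -> R) (B : {linear V -> V}) u w :
  is_funcalc f T B ->
  dot (B u) w = \sum_(p <- s) f p.1 * (dot u p.2 * dot w p.2).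
Proof.
move=> hB; rewrite (inner_sym dotP) {1}(s_full u) linear_sum (inner_sumr dotP).
rewrite big_seq [RHS]big_seq; apply: eq_bigr => p /s_eigen[Tp _].
by rewrite linearZ /= (hB _ _ Tp) !(innerZr dotP) mulrCA.
Qed.

End eigenbasis.

Section opnorm_selfadjoint.
Variables (R : realType) (V : vectType R) (dot : V -> V -> R).
Variable T : {linear V -> V}.
Hypothesis dotP : semi_inner dot.
Hypothesis dot0 : forall u, dot u u = 0 -> u = 0.
Hypothesis Tsym : forall u v, dot (T u) v = dot u (T v).

(** Without this bound the supremum defining the operator norm would be the
    junk value 0. *)
Lemma opnorm_has_ubound :
  has_ubound [set Num.sqrt (dot (T u) (T u)) | u in [set u | dot u u <= 1]].
Proof.
have [s [s1 s2]] := spectral dotP dot0 Tsym.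
pose C := \sum_(p <- s) p.1 ^+ 2.
have C0 : 0 <= C by apply: sumr_ge0 => p _; exact: sqr_ge0.
exists (Num.sqrt C) => _ [u /= u1 <-]; rewrite ler_wsqrtr //.
rewrite (eigenbasis_dot dotP s2).
apply: (@le_trans _ _ (\sum_(p <- s) C * dot u p.2 ^+ 2)).
  rewrite big_seq [leRHS]big_seq; apply: ler_sum => p ps.
  rewrite Tsym (s1 _ ps).1 (innerZr dotP) -expr2 exprMn ler_wpM2r ?sqr_ge0 //.
  rewrite /C (big_rem p) //= lerDl; apply: sumr_ge0 => q _; exact: sqr_ge0.
rewrite -mulr_sumr; apply: ler_piMr => //.
under eq_bigr do rewrite expr2.
by rewrite -(eigenbasis_dot dotP s2).
Qed.

Lemma opnorm_ge0 : 0 <= opnorm dot T.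
Proof.
apply: ub_le_sup; first exact: opnorm_has_ubound.
by exists 0; rewrite /= ?linear0 (inner0l dotP) ?ler01 ?sqrtr0.
Qed.

Lemma eigenvalue_le_opnorm lambda u :
  dot u u = 1 -> T u = lambda *: u -> `|lambda| <= opnorm dot T.
Proof.
move=> u1 Tu; apply: ub_le_sup; first exact: opnorm_has_ubound.
exists u; rewrite /= ?u1 // Tu (innerZl dotP) (innerZr dotP) u1 mulr1 -expr2.
by rewrite sqrtr_sqr.
Qed.

Lemma quadratic_le_opnorm u : `|dot (T u) u| <= opnorm dot T * dot u u.
Proof.
have [s [s1 s2]] := spectral dotP dot0 Tsym.
rewrite !(eigenbasis_dot dotP s2) mulr_sumr.
apply: le_trans (ler_norm_sum _ _ _) _.
rewrite big_seq [leRHS]big_seq; apply: ler_sum => p /s1[Tp p1].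
rewrite Tsym Tp (innerZr dotP) -mulrA normrM -expr2 [X in _ * X]ger0_norm ?sqr_ge0 //.
by rewrite ler_wpM2r ?sqr_ge0 // (eigenvalue_le_opnorm p1 Tp).
Qed.

End opnorm_selfadjoint.

(** * Consequences of the stepsize restrictions *)

Section CFL.
Variable R : realType.

Lemma tau_CFL_Psi_le (beta : \bar R) (tau nrm m : R) :
  (0 < beta)%E -> 0 < tau -> 0 <= m <= nrm ->
  (tau%:E <= tau_CFL_Psi beta nrm)%E -> ((tau ^+ 2 * m)%:E <= beta ^+ 2)%E.
Proof.
move=> beta0 tau0 /andP[m0 mn]; rewrite /tau_CFL_Psi.
case: eqVneq => [n0 _|n0].
  have -> : m = 0 by apply/le_anti; rewrite m0 andbT -n0.
  by rewrite mulr0 expe_ge0 // ltW.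
have np : 0 < nrm by rewrite lt0r n0 (le_trans m0).
rewrite !expe2; case: beta beta0 => [b| |] // b0; last by rewrite mulyy leey.
rewrite -!EFinM /= !lee_fin => h.
apply: le_trans (ler_wpM2l (sqr_ge0 tau) mn) _.
rewrite -ler_pdivlMr // -(@ler_sqrt _ (tau ^+ 2)).
  by rewrite sqrtr_sqr (gtr0_norm tau0) /=.
by rewrite divr_ge0 ?mulr_ge0 ?(ltW np) // ?ltW // -lte_fin.
Qed.

Lemma tau_CFL_lf_le (c vartheta tau nrm : R) :
  0 <= c -> 0 <= nrm -> 0 < tau ->
  (tau%:E <= tau_CFL_lf c vartheta nrm)%E ->
  tau ^+ 2 / 4 * nrm <= c * vartheta ^+ 2.
Proof.
move=> c0 n0 tau0; rewrite /tau_CFL_lf; case: eqVneq => [-> _|nN0].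
  by rewrite mulr0 mulr_ge0 ?sqr_ge0.
have np : 0 < nrm by rewrite lt0r nN0.
rewrite lee_fin => h; suff : tau ^+ 2 <= 4 * c * vartheta ^+ 2 / nrm.
  by rewrite ler_pdivlMr // => h'; lra.
rewrite -(@ler_sqrt _ (tau ^+ 2)) ?sqrtr_sqr ?(gtr0_norm tau0) //.
by rewrite divr_ge0 // mulr_ge0 ?sqr_ge0 // mulr_ge0.
Qed.

End CFL.

Section filter_quadratic_bounds.
Variables (R : realType) (V : vectType R) (dot : V -> V -> R).
Variables (T : {linear V -> V}) (B : {linear V -> V}).
Variables (Psi : R -> R) (cTheta : R) (beta : \bar R) (tau : R).
Hypothesis dotP : semi_inner dot.
Hypothesis dot0 : forall u, dot u u = 0 -> u = 0.
Hypothesis Tsym : forall u v, dot (T u) v = dot u (T v).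
Hypothesis T_le0 : forall u, dot (T u) u <= 0.
Hypothesis beta_gt0 : (0 < beta)%E.
Hypothesis Psi_bounds : filter_bounds Psi cTheta beta.
Hypothesis tau_gt0 : 0 < tau.
Hypothesis tau_CFL : (tau%:E <= tau_CFL_Psi beta (opnorm dot T))%E.
Hypothesis B_Theta : is_funcalc (Theta Psi) (fun u => - (tau ^+ 2 *: T u)) B.

(** In an eigenbasis of T with eigenvalues l <= 0, all three claims are claims
    on Theta(z) at z = - tau^2 l, which lies in [0, beta^2] because |l| is at
    most the operator norm.  The last one is the identity
    Theta(z) + z/4 = 1 / Psi(z) together with Psi(z) <= 1. *)
Lemma filter_quadratic :
  [/\ forall u w, dot (B u) w = dot u (B w),
      forall u, cTheta * dot u u <= dot (B u) u &
      forall u, dot u u <= dot (B u - (tau ^+ 2 / 4) *: T u) u].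
Proof.
have [s [s1 s2]] := spectral dotP dot0 Tsym.
have BT : is_funcalc (fun l => Theta Psi (- (tau ^+ 2 * l))) T B.
  by move=> l w Tw; apply: B_Theta; rewrite Tw scalerA scaleNr.
have TT : is_funcalc id T T by [].
have z_bounds p : p \in s ->
    [/\ 0 < Psi (- (tau ^+ 2 * p.1)), Psi (- (tau ^+ 2 * p.1)) <= 1 &
        cTheta <= Theta Psi (- (tau ^+ 2 * p.1))].
  move=> /s1[Tp p1].
  have le0 : p.1 <= 0.
    by have := T_le0 p.2; rewrite Tp (innerZl dotP) p1 mulr1.
  have nrm := eigenvalue_le_opnorm dotP dot0 Tsym p1 Tp.
  rewrite -mulrN; apply: Psi_bounds; first by rewrite mulr_ge0 ?sqr_ge0 ?oppr_ge0.
  apply: tau_CFL_Psi_le beta_gt0 tau_gt0 _ tau_CFL.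
  by rewrite oppr_ge0 le0 /= -(ler0_norm le0).
have Bdot u w := eigenbasis_dot_funcalc dotP s1 s2 u w BT.
have Tdot u w := eigenbasis_dot_funcalc dotP s1 s2 u w TT.
split=> [u w|u|u].
- rewrite (inner_sym dotP u) !Bdot; apply: eq_bigr => p _.
  by rewrite (mulrC (dot u _)).
- rewrite Bdot (eigenbasis_dot dotP s2 u u) mulr_sumr big_seq [leRHS]big_seq.
  by apply: ler_sum => p /z_bounds[_ _ h]; rewrite ler_wpM2r // -expr2 sqr_ge0.
- rewrite (innerDl dotP) (innerNl dotP) (innerZl dotP) Bdot Tdot.
  rewrite (eigenbasis_dot dotP s2 u u) mulr_sumr -sumrB big_seq [leRHS]big_seq.
  apply: ler_sum => p /z_bounds[Psi0 Psi1 _].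
  have q0 : 0 <= dot u p.2 * dot u p.2 by rewrite -expr2 sqr_ge0.
  have inv1 : 1 <= (Psi (- (tau ^+ 2 * p.1)))^-1 by rewrite invf_ge1.
  by have := ler_wpM2r q0 inv1; rewrite /Theta; lra.
Qed.

End filter_quadratic_bounds.

(** * Energy estimate for the two-field recursion *)

Section scheme_stability.
Variables (R : realType) (U : vectType R) (V : lmodType R).
Variables (dotU : U -> U -> R) (dotV : V -> V -> R).
Variables (Lu : {linear U -> V}) (Lv : {linear V -> U}) (chilf : {linear V -> V}).
Variables (Th : {linear U -> U}) (tau kappa : R).

Definition dot2 (x y : U * V) := dotU x.1 y.1 + dotV x.2 y.2.

(** (D x, y), where D is the part common to R_+ and R_-. *)
Definition energy (x y : U * V) :=
  dotU (Th x.1 + (tau ^+ 2 / 4) *: Lv (chilf (Lu x.1))) y.1 + dotV x.2 y.2.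

Hypothesis dotUP : semi_inner dotU.
Hypothesis dotU0 : forall u, dotU u u = 0 -> u = 0.
Hypothesis dotVP : semi_inner dotV.
Hypothesis Ladj : forall u v, dotV (Lu u) v = - dotU u (Lv v).
Hypothesis chilf_sym : forall v w, dotV (chilf v) w = dotV v (chilf w).
Hypothesis chilf_ge0 : forall v, 0 <= dotV (chilf v) v.
Hypothesis Th_sym : forall u w, dotU (Th u) w = dotU u (Th w).
Hypothesis tau_gt0 : 0 < tau.
Hypothesis kappa_gt0 : 0 < kappa.
Hypothesis kappa_le1 : kappa <= 1.
(* Lu - chilf Lu is the contribution of the filtered elements: the operator
   below is the inverse of the filter. *)
Hypothesis filter_ge1 : forall u,
  dotU u u <= dotU (Th u - (tau ^+ 2 / 4) *: Lv (Lu u - chilf (Lu u))) u.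
Hypothesis coercive : forall u,
  kappa * dotU u u <= dotU (Th u + (tau ^+ 2 / 4) *: Lv (chilf (Lu u))) u.

Let Rm := Rop Lu Lv chilf Th (-1) tau.
Let Rp := Rop Lu Lv chilf Th 1 tau.

Let bilU := (innerDl dotUP, innerDr dotUP, innerZl dotUP, innerZr dotUP,
  innerNl dotUP, innerNr dotUP).
Let bilV := (innerDl dotVP, innerDr dotVP, innerZl dotVP, innerZr dotVP,
  innerNl dotVP, innerNr dotVP).

Lemma LvL u v : dotU (Lv v) u = - dotV v (Lu u).
Proof. by rewrite (inner_sym dotVP) Ladj opprK (inner_sym dotUP). Qed.

Lemma dot2P : semi_inner dot2.
Proof.
split=> [u v|a u v w|u]; rewrite /dot2.
- by rewrite (inner_sym dotUP) (inner_sym dotVP).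
- by rewrite /= !bilU !bilV; lra.
- by rewrite addr_ge0 ?(inner_ge0 dotUP) ?(inner_ge0 dotVP).
Qed.

Lemma energy_coercive x : kappa * dot2 x x <= energy x x.
Proof.
by rewrite mulrDr lerD ?coercive // ler_piMl ?(inner_ge0 dotVP).
Qed.

Lemma energyP : semi_inner energy.
Proof.
split=> [u v|a u v w|u]; last first.
- apply: le_trans (energy_coercive u).
  by rewrite mulr_ge0 ?(ltW kappa_gt0) ?(inner_ge0 dot2P).
- rewrite /energy /= !linearP /= !bilU !bilV; lra.
- rewrite /energy !bilU !LvL (inner_sym dotVP u.2) Th_sym (inner_sym dotUP u.1).
  by rewrite chilf_sym (inner_sym dotVP (Lu u.1)).
Qed.

(** Eliminating the second component from R_- (u, v) = g leaves the equation
    G u = g_u + (tau/2) Lv g_v with G the inverse of the filter, and G >= 1 is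
    injective, hence onto in finite dimension. *)
Lemma Rm_surj g : exists z, Rm z = g.
Proof.
pose GG : {linear U -> U} := GRing.Linear.clone _ _ _ _
  (Th \- ((tau ^+ 2 / 4) \*: (Lv \o (Lu \- (chilf \o Lu))))) _.
pose G u := Th u - (tau ^+ 2 / 4) *: Lv (Lu u - chilf (Lu u)).
have k0 : lker (linfun GG) == 0%VS.
  apply/eqP/vspaceP => u; rewrite memv_ker memv0 lfunE /=.
  apply/eqP/eqP => [Gu0|->]; last exact: (linear0 GG).
  apply: dotU0; apply/le_anti; rewrite (inner_ge0 dotUP) andbT.
  have {}Gu0 : G u = 0 by exact: Gu0.
  by apply: le_trans (filter_ge1 u) _; rewrite -/(G u) Gu0 (inner0l dotUP).
have /memv_imgP[u _] : g.1 + (tau / 2) *: Lv g.2 \in limg (linfun GG).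
  by rewrite lker0_limgf ?memvf.
rewrite lfunE => /eqP; rewrite -[GG u]/(G u) eq_sym -subr_eq => /eqP uE.
exists (u, g.2 + (tau / 2) *: Lu u); rewrite /Rm /Rop /= [RHS]surjective_pairing.
congr (_, _); last by rewrite mulN1r scaleNr addrCA addNr addr0.
rewrite -uE /G linearD linearZ linearB /= mulN1r scaleNr scalerDr scalerA.
rewrite (_ : tau / 2 * (tau / 2) = tau ^+ 2 / 4); last by field.
rewrite scalerN opprK scalerBr !opprD opprK !addrA.
by rewrite [RHS]addrAC; congr (_ + _); rewrite addrAC.
Qed.

(** Combine |g_u - u|^2 >= 0 with the lower bound 1 of the inverse filter: after
    the substitution g_v = v - (tau/2) Lu u the cross terms cancel. *)
Lemma Rm_energy z g : Rm z = g -> energy z z <= dot2 g g.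
Proof.
move=> <-; rewrite /energy /dot2 /Rm /Rop /=; set u := z.1; set v := z.2.
set gu := (X in _ <= dotU X X + _).
have guu : dotU gu u = dotU (Th u) u + tau / 2 * dotV v (Lu u)
    - tau ^+ 2 / 4 * dotV (chilf (Lu u)) (Lu u).
  by rewrite /gu !bilU !LvL; ring.
move: gu guu => gu guu.
have := inner_ge0 dotUP (gu - u).
rewrite !bilU (inner_sym dotUP u gu) guu.
have := filter_ge1 u; rewrite !bilU !bilV !LvL !bilV (inner_sym dotVP (Lu u) v).
lra.
Qed.

(** A Cayley transform of a skew-adjoint operator is an isometry: pair both
    component equations with w + x. *)
Lemma Rm_Rp_energy w x : Rm w = Rp x -> energy w w = energy x x.
Proof.
rewrite /Rm /Rp /Rop => -[].
move=> /(congr1 (fun z => dotU z (w.1 + x.1))) E1.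
move=> /(congr1 (fun z => dotV z (w.2 + x.2))) E2.
have := inner_sym energyP (w.1, 0) (x.1, 0).
move: E1 E2; rewrite /energy /= !bilU !bilV !LvL !(inner0l dotVP).
rewrite !(inner_sym dotVP (Lu w.1)) !(inner_sym dotVP (Lu x.1)).
by rewrite (inner_sym dotVP w.2 x.2); lra.
Qed.

Lemma RopB (s : R) (x y : U * V) : Rop Lu Lv chilf Th s tau (x - y) =
  Rop Lu Lv chilf Th s tau x - Rop Lu Lv chilf Th s tau y.
Proof.
pose F1 : {linear (U * V)%type -> U} := GRing.Linear.clone _ _ _ _
  (Th \o fst \+ (s * (tau / 2)) \*: (Lv \o snd) \-
   (tau ^+ 2 / 4) \*: (\- (Lv \o chilf \o Lu \o fst))) _.
pose F2 : {linear (U * V)%type -> V} := GRing.Linear.clone _ _ _ _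
  ((s * (tau / 2)) \*: (Lu \o fst) \+ snd) _.
by have /= := (linearB F1 x y, linearB F2 x y); rewrite /Rop => -[-> ->].
Qed.

(** With R_- z = tau g, the difference y - z is a homogeneous step from x. *)
Lemma scheme_energy_step x y g : Rm y = Rp x + tau *: g ->
  inner_norm energy y <= inner_norm energy x + tau * inner_norm dot2 g.
Proof.
move=> hy; have [z zE] := Rm_surj (tau *: g).
have w : Rm (y - z) = Rp x.
  by rewrite /Rm RopB -/Rm zE hy addrK.
rewrite -(subrK z y); apply: le_trans (inner_normD energyP _ _) _.
apply: lerD; first by rewrite /inner_norm (Rm_Rp_energy w).
rewrite -(gtr0_norm tau_gt0) -sqrtr_sqr -sqrtrM ?sqr_ge0 //.
rewrite ler_wsqrtr // (le_trans (Rm_energy zE)) //.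
by rewrite (innerZl dot2P) (innerZr dot2P) mulrA -expr2.
Qed.

Theorem scheme_stability (x g : nat -> U * V) n :
  (forall n, Rm (x n.+1) = Rp (x n) + tau *: g n) ->
  inner_norm dot2 (x n.+1) <= (Num.sqrt kappa)^-1 *
    (Num.sqrt (dot2 (ThetaI Th (x 0)) (x 0)) +
     tau * \sum_(j < n.+1) inner_norm dot2 (g j)).
Proof.
move=> hx.
have H m : inner_norm energy (x m) <=
    inner_norm energy (x 0) + tau * \sum_(j < m) inner_norm dot2 (g j).
  elim: m => [|m IH]; first by rewrite big_ord0 mulr0 addr0.
  apply: le_trans (scheme_energy_step (hx m)) _.
  by rewrite big_ord_recr /= mulrDr addrA lerD2r.
rewrite ler_pdivlMl ?sqrtr_gt0 // -sqrtrM ?(ltW kappa_gt0) //.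
apply: le_trans (ler_wsqrtr (energy_coercive _)) _.
apply: le_trans (H n.+1) _; rewrite lerD2r ler_wsqrtr // /energy /dot2 /= lerD2r.
by rewrite !bilU gerDl LvL mulrN oppr_le0 mulr_ge0 // divr_ge0 // sqr_ge0.
Qed.

End scheme_stability.

(** Pm and Plf stand for the multiplications by the indicator functions. *)
Section local_scheme.
Variables (R : realType) (U : vectType R) (V : lmodType R).
Variables (dotU : U -> U -> R) (dotV : V -> V -> R).
Variables (Lu : {linear U -> V}) (Lv : {linear V -> U}).
Variables (Pm Plf : {linear V -> V}) (Th : {linear U -> U}).
Variables (Psi : R -> R) (cTheta vartheta tau : R) (beta : \bar R).
Hypothesis dotUP : semi_inner dotU.
Hypothesis dotU0 : forall u, dotU u u = 0 -> u = 0.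
Hypothesis dotVP : semi_inner dotV.
Hypothesis Ladj : forall u v, dotV (Lu u) v = - dotU u (Lv v).
Hypothesis Pm_sym : forall v w, dotV (Pm v) w = dotV v (Pm w).
Hypothesis Pm_ge0 : forall v, 0 <= dotV (Pm v) v.
Hypothesis Plf_sym : forall v w, dotV (Plf v) w = dotV v (Plf w).
Hypothesis Plf_ge0 : forall v, 0 <= dotV (Plf v) v.
Hypothesis PlfC : forall v, v - Plf v = Pm v.
Hypothesis cTheta_itv : 0 < cTheta <= 1.
Hypothesis beta_max : is_betaPsi Psi cTheta beta.
Hypothesis vartheta_itv : 0 < vartheta < 1.
Hypothesis tau_gt0 : 0 < tau.
Hypothesis tau_m : (tau%:E <= tau_CFL_Psi beta (opnorm dotU (Lv \o Pm \o Lu)))%E.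
Hypothesis tau_lf :
  (tau%:E <= tau_CFL_lf cTheta vartheta (opnorm dotU (Lv \o Plf \o Lu)))%E.
Hypothesis Th_Theta :
  is_funcalc (Theta Psi) (fun u => - (tau ^+ 2 *: Lv (Pm (Lu u)))) Th.

Let LPL (P : {linear V -> V}) : {linear U -> U} :=
  GRing.Linear.clone _ _ _ _ (Lv \o P \o Lu) _.

Lemma LPL_dot (P : {linear V -> V}) u w :
  dotU (LPL P u) w = - dotV (P (Lu u)) (Lu w).
Proof. by rewrite (inner_sym dotVP) Ladj opprK (inner_sym dotUP). Qed.

Lemma LPL_sym (P : {linear V -> V}) :
  (forall v w, dotV (P v) w = dotV v (P w)) ->
  forall u w, dotU (LPL P u) w = dotU u (LPL P w).
Proof.
by move=> Psym u w; rewrite (inner_sym dotUP u) !LPL_dot Psym (inner_sym dotVP).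
Qed.

Theorem local_scheme_stability (x g : nat -> U * V) n :
  (forall n, Rop Lu Lv Plf Th (-1) tau (x n.+1) =
    Rop Lu Lv Plf Th 1 tau (x n) + tau *: g n) ->
  inner_norm (dot2 dotU dotV) (x n.+1) <=
    (Num.sqrt (cTheta * (1 - vartheta ^+ 2)))^-1 *
    (Num.sqrt (dot2 dotU dotV (ThetaI Th (x 0)) (x 0)) +
     tau * \sum_(j < n.+1) inner_norm (dot2 dotU dotV) (g j)).
Proof.
have [beta0 Psi_bounds _] := beta_max.
have [/andP[c0 c1] /andP[t0 t1]] := (cTheta_itv, vartheta_itv).
have tt1 : vartheta ^+ 2 < 1 by rewrite expr_lt1 // ltW.
have tt0 := sqr_ge0 vartheta.
have Tm_le0 u : dotU (LPL Pm u) u <= 0.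
  by rewrite LPL_dot oppr_le0 Pm_ge0.
have [Th_sym Th_ge Th_filter] := filter_quadratic dotUP dotU0 (LPL_sym Pm_sym)
  Tm_le0 beta0 Psi_bounds tau_gt0 tau_m Th_Theta.
apply: scheme_stability => //.
- by rewrite mulr_gt0 // subr_gt0.
- by rewrite mulr_ile1 ?subr_ge0 ?(ltW tt1) ?(ltW c0) // lerBlDr lerDl.
- by move=> u; rewrite PlfC; exact: Th_filter.
move=> u; rewrite (innerDl dotUP) (innerZl dotUP).
have := quadratic_le_opnorm dotUP dotU0 (LPL_sym Plf_sym) u.
rewrite ler_norml => /andP[lower _].
have nrm0 := opnorm_ge0 dotUP dotU0 (LPL_sym Plf_sym).
have uu := inner_ge0 dotUP u.
have := tau_CFL_lf_le (ltW c0) nrm0 tau_gt0 tau_lf.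
move=> /(ler_wpM2r uu) h.
have tau4 : 0 <= tau ^+ 2 / 4 by rewrite divr_ge0 ?sqr_ge0.
by have := ler_wpM2l tau4 lower; have := Th_ge u; rewrite /=; lra.
Qed.

End local_scheme.

(** * Polynomials vanishing on an open set *)

(** Induction on the number of digits: the lowest one is the remainder
    modulo b. *)
Lemma digits_inj (b d : nat) (x y : 'I_d -> nat) :
  (forall i, (x i < b)%N) -> (forall i, (y i < b)%N) ->
  (\sum_i x i * b ^ i = \sum_i y i * b ^ i)%N -> x =1 y.
Proof.
elim: d x y => [|d IH] x y xb yb; first by move=> _ [].
have shift (z : 'I_d.+1 -> nat) :
    (\sum_i z i * b ^ i = (\sum_(i < d) z (lift ord0 i) * b ^ i) * b + z ord0)%N.
  rewrite big_ord_recl muln1 addnC big_distrl /=; congr (_ + _)%N.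
  by apply: eq_bigr => i _; rewrite expnSr mulnA.
rewrite !shift => E.
have E0 : x ord0 = y ord0.
  by have /(congr1 (modn^~ b)) := E; rewrite !modnMDl !modn_small.
have b0 : (0 < b)%N by apply: leq_ltn_trans (xb ord0).
move: E; rewrite E0 => /addIn/eqP; rewrite eqn_pmul2r // => /eqP E i.
case: (unliftP ord0 i) => [j ->|->//].
exact: (IH (fun j => x (lift ord0 j)) (fun j => y (lift ord0 j))).
Qed.

Lemma poly_inj_roots (R : idomainType) (q : {poly R}) (r : nat -> R) :
  injective r -> (forall n, q.[r n] = 0) -> q = 0.
Proof.
move=> r_inj qr; apply/eqP; apply: contraT => q0.
have := @max_poly_roots _ q [seq r i | i <- iota 0 (size q)] q0.
rewrite size_map size_iota ltnn map_inj_uniq ?iota_uniq // => -> //.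
by apply/allP => _ /mapP[n _ ->]; rewrite /root qr.
Qed.

Section polynomial_identity.
Variables (R : realType) (d k : nat).
Implicit Type p : {ffun expo d k -> R^o}.

(** Restricted to the line through a point x of the open set and any y, the
    polynomial vanishes for all small parameters, hence also at y. *)
Lemma peval_eq0_open p (W : set 'rV[R]_d) : open W -> W !=set0 ->
  (forall x, W x -> peval p x = 0) -> forall y, peval p y = 0.
Proof.
move=> oW [x Wx] pW y.
pose q : {poly R} := \sum_(a : expo d k)
  p a *: \prod_(i < d) ((x ord0 i)%:P + (y ord0 i - x ord0 i)%:P * 'X) ^+ (val a i).
have qE t : q.[t] = peval p (x + t *: (y - x)).
  rewrite /q /peval horner_sum; apply: eq_bigr => a _.
  rewrite hornerZ horner_prod; congr (_ * _); apply: eq_bigr => i _.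
  by rewrite horner_exp !hornerE !mxE mulrC.
suff q0 : q = 0.
  have := qE 1; rewrite q0 horner0 scale1r addrC subrK => <-//.
have /nbhs_ballP[e /= e0 eW] := open_nbhs_nbhs (conj oW Wx).
pose c := e / (`|y - x| + 1).
have N1 : 0 < `|y - x| + 1 by rewrite ltr_wpDl.
have c0 : 0 < c by rewrite divr_gt0.
apply: (@poly_inj_roots _ _ (fun n => c / n.+1%:R)) => [m n|n].
  by move=> /(mulfI (lt0r_neq0 c0))/invr_inj/eqP; rewrite eqr_nat => /eqP[].
rewrite qE; apply/pW/eW; rewrite -ball_normE /= opprD addrA subrr sub0r normrN.
rewrite normrZ gtr0_norm ?divr_gt0 // mulrAC.
apply: (@le_lt_trans _ _ (c * `|y - x|)).
  by rewrite ler_pdivrMr // ler_peMr ?ler1n // mulr_ge0 // ltW.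
by rewrite /c mulrAC ltr_pdivrMr // ltr_pM2l // ltrDl.
Qed.

(** Kronecker substitution: at x_i = t^((k+1)^i) the monomial of exponent a
    becomes t^code(a), and the codes are distinct because the a_i are digits
    in base k+1. *)
Lemma peval_inj p : (forall y : 'rV[R]_d, peval p y = 0) -> p = 0.
Proof.
move=> p0.
pose code (a : expo d k) := (\sum_(i < d) val a i * k.+1 ^ i)%N.
have code_inj : injective code.
  move=> a b /digits_inj ab; apply: val_inj; apply/ffunP => i; apply: val_inj.
  by apply: ab => j; exact: ltn_ord.
pose q : {poly R} := \sum_(a : expo d k) p a *: 'X^(code a).
have q0 : q = 0.
  apply: (@poly_inj_roots _ _ (fun n => n%:R)) => [m n /eqP|n].
    by rewrite eqr_nat => /eqP.
  rewrite /q horner_sum -[RHS](p0 (\row_(i < d) (n%:R ^+ (k.+1 ^ i)))).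
  apply: eq_bigr => a _; rewrite hornerZ hornerXn; congr (_ * _).
  rewrite /code (big_morph _ (exprD _) (expr0 _)); apply: eq_bigr => i _.
  by rewrite mxE -exprM mulnC.
apply/ffunP => a; rewrite ffunE.
have /(congr1 (fun z : {poly R} => z`_(code a))) := q0.
rewrite coef0 coef_sum (bigD1 a) //= coefZ coefXn eqxx mulr1 big1 ?addr0 // => b ba.
by rewrite coefZ coefXn (inj_eq code_inj) eq_sym (negPf ba) mulr0.
Qed.

End polynomial_identity.

(** * The weighted inner product on broken polynomials *)

Section lebesgue_rV_bounds.
Variables (R : realType) (d : nat).

Lemma bounded_set_coord (A : set 'rV[R]_d) : bounded_set A ->
  exists2 B : R, 0 <= B & forall x, A x -> forall i, `|x ord0 i| <= B.
Proof.
case=> B0 [_ /(_ (`|B0| + 1))]; rewrite (le_lt_trans (ler_norm _)) ?ltrDl // => /(_ isT) H.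
exists (`|B0| + 1); first by rewrite addr_ge0.
move=> x /H /= xB i; apply: le_trans xB.
rewrite [leRHS]mx_normrE.
exact: (le_bigmax _ (fun ij => `|x ij.1 ij.2|) (ord0, i)).
Qed.

(** Balls of the maximum norm are boxes. *)
Lemma lebesgue_rV_ball (x : 'rV[R]_d) (e : R) : 0 < e ->
  lebesgue_rV R d (ball x e) = ((e *+ 2) ^+ d)%:E.
Proof.
move=> e0.
have -> : ball x e = [set y : 'rV[R]_d | forall i, ball (x ord0 i) e (y ord0 i)].
  apply/seteqP; split=> y /=.
    by move=> [_ xy] i; exact: xy.
  by move=> xy; split=> // i j; rewrite (ord1 i); exact: xy.
rewrite (@lebesgue_rV_box R d (fun i => ball (x ord0 i) e)); last first.
  by move=> i; apply: open_measurable; exact: ball_open.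
under eq_bigr do rewrite lebesgue_measure_ball ?ltW //.
by rewrite prodEFin prodr_const card_ord.
Qed.

Lemma lebesgue_rV_lty (A : set 'rV[R]_d) : measurable A -> bounded_set A ->
  (lebesgue_rV R d A < +oo)%E.
Proof.
move=> mA /bounded_set_coord[B B0 AB].
have AS : A `<=` ball (0 : 'rV[R]_d) (B + 1).
  move=> x /AB xB; split=> [|i j]; first by rewrite ltr_wpDl.
  rewrite (ord1 i) mxE -ball_normE /= sub0r normrN.
  by rewrite (le_lt_trans (xB j)) // ltrDl.
apply: (@le_lt_trans _ _ (lebesgue_rV R d (ball (0 : 'rV[R]_d) (B + 1)))).
  apply: le_measure => //; rewrite inE //; apply: open_measurable_rV.
  exact: ball_open.
by rewrite lebesgue_rV_ball ?ltry // ltr_wpDl.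
Qed.

End lebesgue_rV_bounds.

Section inner_product.
Variables (R : realType) (d N m k : nat) (Omega : set 'rV[R]_d).
Variables (K : 'I_N -> set 'rV[R]_d) (M : 'rV[R]_d -> 'M[R]_m).
Hypothesis Omega_open : open Omega.
Hypothesis Omega_bounded : bounded_set Omega.
Hypothesis K_mesh : is_mesh Omega K.
Hypothesis M_weight : is_weight Omega M.

Let mu := lebesgue_rV R d.
Implicit Types u w : Vh R d N m k.

Let integrand u w (x : 'rV[R]_d) : R := dotc (M x *m fun_of K u x) (fun_of K w x).

Lemma fun_ofE u x j :
  fun_of K u x j ord0 = \sum_(i < N) (\1_(K i) x : R) * peval (u i j) x.
Proof.
by rewrite /fun_of summxE; apply: eq_bigr => i _; rewrite !mxE.
Qed.

Lemma fun_of_linear a u w x :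
  fun_of K (a *: u + w) x = a *: fun_of K u x + fun_of K w x.
Proof.
apply/colP => j; rewrite !mxE !fun_ofE mulr_sumr -big_split /=.
apply: eq_bigr => i _; rewrite mulrCA -mulrDr; congr (_ * _).
rewrite /peval mulr_sumr -big_split /=; apply: eq_bigr => b _.
by rewrite !ffunE /= mulrDl mulrA.
Qed.

Lemma measurable_peval (p : {ffun expo d k -> R^o}) :
  measurable_fun setT (fun x : 'rV[R]_d => peval p x).
Proof.
apply: measurable_sum => a; apply: measurable_funM => //.
apply: measurable_prod => i _; apply: measurable_funX.
exact: measurable_coord_rV.
Qed.

Lemma continuous_peval (p : {ffun expo d k -> R^o}) :
  continuous (fun x : 'rV[R]_d => peval p x).
Proof.
apply: (@continuous_big _ _ _ _ _ (@add_continuous R)) => a _ x.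
apply: continuousM; first exact: cst_continuous.
apply: (@continuous_big _ _ _ _ _ (@mul_continuous R)) => i _ y.
apply: (@continuous_comp _ _ _ (fun z : 'rV[R]_d => z ord0 i) (fun t => t ^+ val a i)).
  exact: coord_continuous.
exact: exprn_continuous.
Qed.

Lemma measurable_fun_of u j : measurable_fun Omega (fun x => fun_of K u x j ord0).
Proof.
under eq_fun do rewrite fun_ofE.
apply: measurable_funTS; apply: measurable_sum => i; apply: measurable_funM.
  apply: measurable_indic; apply: open_measurable_rV.
  by case: K_mesh => /(_ i)[].
exact: measurable_peval.
Qed.

Lemma peval_bounded (p : {ffun expo d k -> R^o}) :
  exists2 C : R, 0 <= C & forall x, Omega x -> `|peval p x| <= C.
Proof.
have [B B0 OB] := bounded_set_coord Omega_bounded.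
exists (\sum_(a : expo d k) `|p a| * \prod_(i < d) B ^+ (val a i)).
  by apply: sumr_ge0 => a _; rewrite mulr_ge0 // prodr_ge0 // => i _; rewrite exprn_ge0.
move=> x Ox; apply: le_trans (ler_norm_sum _ _ _) _; apply: ler_sum => a _.
rewrite normrM ler_wpM2l // normr_prod; apply: ler_prod => i _.
by rewrite normr_ge0 normrX lerXn2r ?nnegrE // OB.
Qed.

Lemma fun_of_bounded u :
  exists2 C : R, 0 <= C & forall x, Omega x -> forall j, `|fun_of K u x j ord0| <= C.
Proof.
have /choice[C CP] (ij : 'I_N * 'I_m) : exists C : R,
    0 <= C /\ forall x, Omega x -> `|peval (u ij.1 ij.2) x| <= C.
  by have [C] := peval_bounded (u ij.1 ij.2); exists C.
exists (\sum_ij C ij); first by apply: sumr_ge0 => ij _; case: (CP ij).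
move=> x Ox j; rewrite fun_ofE; apply: le_trans (ler_norm_sum _ _ _) _.
apply: (@le_trans _ _ (\sum_i C (i, j))).
  apply: ler_sum => i _; rewrite normrM indicE.
  case: (x \in K i); last by rewrite normr0 mul0r; case: (CP (i, j)).
  by rewrite normr1 mul1r; case: (CP (i, j)) => _; apply.
rewrite [leRHS](eq_bigr (fun p => C (p.1, p.2))); last by case.
rewrite -(pair_bigA _ (fun i j => C (i, j))) /=; apply: ler_sum => i _.
by rewrite (bigD1 j) //= lerDl sumr_ge0 // => l _; case: (CP (i, l)).
Qed.

Let mOmega : measurable Omega := open_measurable_rV Omega_open.

Lemma measurable_integrand u w : measurable_fun Omega (integrand u w).
Proof.
apply: measurable_sum => a; apply: measurable_funM; last exact: measurable_fun_of.
under eq_fun do rewrite mxE.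
apply: measurable_sum => b; apply: measurable_funM; last exact: measurable_fun_of.
by case: M_weight.
Qed.

Lemma measurable_EFin_integrand u w : measurable_fun Omega (EFin \o integrand u w).
Proof. apply/measurable_EFinP; exact: measurable_integrand. Qed.

Lemma integrand_integrable u w : mu.-integrable Omega (EFin \o integrand u w).
Proof.
have [CM CMP] : exists CM : R, {ae mu, forall x, Omega x ->
  forall i j, `|M x i j| <= CM} by case: M_weight.
have [Cu Cu0 CuP] := fun_of_bounded u; have [Cw Cw0 CwP] := fun_of_bounded w.
pose C := \sum_(a < m) \sum_(b < m) CM * Cu * Cw.
apply/integrableP; split; first exact: measurable_EFin_integrand.
apply: (@le_lt_trans _ _ (\int[mu]_(x in Omega) `|C|%:E)%E).
  apply: ae_ge0_le_integral => //.
  - by apply/measurable_EFinP; apply: measurableT_comp => //; exact: measurable_integrand.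
  - apply: filterS CMP => x Mx Ox; rewrite /= lee_fin.
    apply: le_trans (ler_norm_sum _ _ _) _; apply: le_trans (ler_norm _).
    apply: ler_sum => a _; rewrite mxE mulr_suml.
    apply: le_trans (ler_norm_sum _ _ _) _; apply: ler_sum => b _.
    by rewrite !normrM !ler_pM ?mulr_ge0 ?normr_ge0 ?Mx ?CuP ?CwP.
rewrite integral_cst // lte_mul_pinfty ?lee_fin //.
exact: lebesgue_rV_lty.
Qed.

Lemma ip_linear a u v w :
  ip Omega K M (a *: u + v) w = a * ip Omega K M u w + ip Omega K M v w.
Proof.
rewrite /ip -RintegralZl //; last exact: integrand_integrable.
rewrite -RintegralD //; last exact: integrand_integrable; last first.
  exact: (integrableZl mOmega a (integrand_integrable u w)).
apply: eq_Rintegral => x _; rewrite fun_of_linear mulmxDr -scalemxAr.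
rewrite /dotc mulr_sumr -big_split /=; apply: eq_bigr => i _.
by rewrite !mxE mulrDl mulrA.
Qed.

Lemma ae_eq_ip u w v z :
  {ae mu, forall x, Omega x -> integrand u w x = integrand v z x} ->
  ip Omega K M u w = ip Omega K M v z.
Proof.
move=> h; rewrite /ip /Rintegral; congr fine; apply: ae_eq_integral => //.
- exact: measurable_EFin_integrand.
- exact: measurable_EFin_integrand.
by apply: filterS h => x h Ox; congr EFin; exact: h.
Qed.

Lemma dotcC (a b : 'cV[R]_m) : dotc a b = dotc b a.
Proof. by apply: eq_bigr => i _; rewrite mulrC. Qed.

Lemma dotc_ge0 (a : 'cV[R]_m) : 0 <= dotc a a.
Proof. by apply: sumr_ge0 => i _; rewrite -expr2 sqr_ge0. Qed.

Lemma dotc_mulmx (A : 'M[R]_m) a b : dotc (A *m a) b = dotc a (A^T *m b).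
Proof.
have dE (x y : 'cV[R]_m) : dotc x y = (x^T *m y) ord0 ord0.
  by rewrite mxE; apply: eq_bigr => i _; rewrite mxE.
by rewrite !dE trmx_mul mulmxA.
Qed.

Lemma ip_sym u w : ip Omega K M u w = ip Omega K M w u.
Proof.
have symM : {ae mu, forall x, Omega x -> (M x)^T = M x} by case: M_weight.
apply: ae_eq_ip; apply: filterS symM => x Mx Ox.
by rewrite /integrand dotc_mulmx (Mx Ox) dotcC.
Qed.

(** The integrand is nonnegative almost everywhere only; with the absolute
    value it is so everywhere, so that the integral is nonnegative and, if it
    is zero, the integrand is zero almost everywhere. *)
Lemma ip_abs u : ip Omega K M u u = \int[mu]_(x in Omega) `|integrand u u x|.
Proof.
have [c c0 cM] : exists2 c : R, 0 < c & {ae mu, forall x, Omega x ->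
  forall xi, c * dotc xi xi <= dotc (M x *m xi) xi} by case: M_weight.
rewrite /ip /Rintegral; congr fine; apply: ae_eq_integral => //.
- exact: measurable_EFin_integrand.
- by apply/measurable_EFinP; apply: measurableT_comp => //; exact: measurable_integrand.
apply: filterS cM => x cM Ox; rewrite ger0_norm //.
by apply: le_trans (cM Ox _); rewrite mulr_ge0 ?dotc_ge0 // ltW.
Qed.

Lemma ip_ge0 u : 0 <= ip Omega K M u u.
Proof. by rewrite ip_abs; apply: Rintegral_ge0. Qed.

Lemma ip_semi_inner : semi_inner (ip Omega K M (k := k)).
Proof. split; [exact: ip_sym|exact: ip_linear|exact: ip_ge0]. Qed.

(** If a polynomial on an element were nonzero at a point, it would be so on a
    ball, which is not negligible. *)
Lemma ip_definite u : ip Omega K M u u = 0 -> u = 0.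
Proof.
rewrite ip_abs => u0.
have [c c0 cM] : exists2 c : R, 0 < c & {ae mu, forall x, Omega x ->
  forall xi, c * dotc xi xi <= dotc (M x *m xi) xi} by case: M_weight.
have f0 : {ae mu, forall x, Omega x -> integrand u u x = 0}.
  have /integrableP[mf foo] := integrand_integrable u u.
  have /(ae_eq_integral_abs _ mOmega mf) : (\int[mu]_(x in Omega)
      `|(EFin \o integrand u u) x| = 0)%E.
    rewrite -[LHS]fineK ?ge0_fin_numE ?integral_ge0 //.
    by congr EFin.
  by apply: filterS => x h /h [].
have [N0 [mN0 N0_null N0P]] : {ae mu, forall x, Omega x ->
    forall j, fun_of K u x j ord0 = 0}.
  apply: filterS2 f0 cM => x f0 cM Ox j.
  have : dotc (fun_of K u x) (fun_of K u x) == 0.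
    by rewrite eq_le dotc_ge0 andbT -(pmulr_rle0 _ c0) -(f0 Ox) cM.
  rewrite psumr_eq0 => [/allP/(_ j)|j' _]; last by rewrite -expr2 sqr_ge0.
  by rewrite mem_index_enum -expr2 sqrf_eq0 => /(_ isT)/eqP.
have [Kp KO Kdisj _] := K_mesh.
apply/ffunP => i; rewrite [RHS]ffunE; apply/ffunP => j; rewrite [RHS]ffunE.
have [oK K0 _ _ _] := Kp i.
apply: peval_inj; apply: (peval_eq0_open oK K0) => x Kx.
have uK y : K i y -> fun_of K u y j ord0 = peval (u i j) y.
  move=> Ky; rewrite fun_ofE (bigD1 i) //= indicE mem_set // mul1r big1 ?addr0 //.
  move=> l li; rewrite indicE memNset ?mul0r // => Kly.
  by have : (K l `&` K i) y by []; rewrite Kdisj.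
apply: contrapT => /eqP pN0.
have cp := @continuous_peval (u i j) x.
have : nbhs x (K i `&` [set y | peval (u i j) y != 0]).
  apply: filterI; first exact: open_nbhs_nbhs.
  exact: cvgr_neq0 cp pN0.
move=> /nbhs_ballP[e /= e0 eK].
have : (mu (ball x e) <= mu N0)%E.
  apply: le_measure; rewrite ?inE //; first by apply: open_measurable_rV; exact: ball_open.
  move=> y /eK[Ky py]; apply: N0P => /= H.
  by move: py; rewrite /= -uK // (H (KO _ _ Ky)) eqxx.
rewrite N0_null /mu lebesgue_rV_ball // leNgt lte_fin exprn_gt0 //.
by rewrite pmulrn_lgt0.
Qed.

End inner_product.

Section chi_theory.
Variables (R : realType) (d N m k : nat).
Implicit Types (S : {set 'I_N}) (u w : Vh R d N m k).

Lemma chi_linear S : linear (@chi R d N m k S).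
Proof.
move=> a u w; apply/ffunP => i; rewrite !ffunE; case: ifP => // _.
by rewrite scaler0 addr0.
Qed.

HB.instance Definition _ S := GRing.isLinear.Build R (Vh R d N m k)
  (Vh R d N m k) _ (@chi R d N m k S) (chi_linear S).

Lemma chi_idem S u : chi S (chi S u) = chi S u.
Proof. by apply/ffunP => i; rewrite !ffunE; case: (i \in S). Qed.

Lemma chiC S u : u - chi (~: S)%SET u = chi S u.
Proof.
apply/ffunP => i; rewrite !ffunE finset.in_setC.
by case: (i \in S) => /=; rewrite ?subr0 ?subrr.
Qed.

Variables (Omega : set 'rV[R]_d) (K : 'I_N -> set 'rV[R]_d).
Variable M : 'rV[R]_d -> 'M[R]_m.
Hypothesis K_disjoint : forall i j, i != j -> K i `&` K j = set0.

Lemma ip_chi S u w : ip Omega K M (chi S u) w = ip Omega K M u (chi S w).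
Proof.
apply: eq_Rintegral => x _; rewrite !fun_of_chi // -scalemxAr /dotc.
by apply: eq_bigr => i _; rewrite !mxE mulrCA mulrA.
Qed.

Hypothesis M_semi_inner : semi_inner (ip Omega K M (k := k)).

Lemma ip_chi_ge0 S u : 0 <= ip Omega K M (chi S u) u.
Proof.
have <- : ip Omega K M (chi S u) (chi S u) = ip Omega K M (chi S u) u.
  by rewrite -ip_chi chi_idem.
exact: (inner_ge0 M_semi_inner).
Qed.

End chi_theory.

(** * Stability of the scheme *)

Theorem lemma3p9 (R : realType) (d N mu mv k : nat) (hd : (0 < d)%N)
  (Omega : set 'rV[R]_d) (hOmega : polytopal Omega)
  (K : 'I_N -> set 'rV[R]_d) (hK : is_mesh Omega K) (Tf : {set 'I_N})
  (Mu : 'rV[R]_d -> 'M[R]_mu) (hMu : is_weight Omega Mu)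
  (Mv : 'rV[R]_d -> 'M[R]_mv) (hMv : is_weight Omega Mv)
  (Lu : {linear Vh R d N mu k -> Vh R d N mv k})
  (Lv : {linear Vh R d N mv k -> Vh R d N mu k})
  (hL : forall u v, ip Omega K Mv (Lu u) v = - ip Omega K Mu u (Lv v))
  (Psi : R -> R) (hPsi : smooth_nonneg Psi) (hPsi0 : Psi 0 = 1)
  (cTheta : R) (hcTheta : 0 < cTheta <= 1)
  (betaPsi : \bar R) (hbeta : is_betaPsi Psi cTheta betaPsi)
  (vartheta : R) (hvartheta : 0 < vartheta < 1)
  (tau : R) (htau0 : 0 < tau)
  (htau : (tau%:E <= mine
     (tau_CFL_Psi betaPsi
        (opnorm (ip Omega K Mu) (Lv \o chi (mesh_m K Tf) \o Lu)))
     (tau_CFL_lf cTheta vartheta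
        (opnorm (ip Omega K Mu) (Lv \o chi (mesh_lf K Tf) \o Lu))))%E)
  (ThetaT : {linear Vh R d N mu k -> Vh R d N mu k})
  (hThetaT : is_funcalc (Theta Psi)
     (fun u => - (tau ^+ 2 *: Lv (chi (mesh_m K Tf) (Lu u)))) ThetaT)
  (x g : nat -> Vh R d N mu k * Vh R d N mv k)
  (hx : forall n,
     Rop Lu Lv (chi (mesh_lf K Tf)) ThetaT (-1) tau (x n.+1) =
     Rop Lu Lv (chi (mesh_lf K Tf)) ThetaT 1 tau (x n) + tau *: g n) :
  let normO y := Num.sqrt (ip2 Omega K Mu Mv y y) in
  let normTheta y := Num.sqrt (ip2 Omega K Mu Mv (ThetaI ThetaT y) y) in
  let Cstb := (Num.sqrt (cTheta * (1 - vartheta ^+ 2)))^-1 in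
  forall n : nat,
    normO (x n.+1) <=
    Cstb * (normTheta (x 0%N) + tau * \sum_(j < n.+1) normO (g j)).
Proof.
move=> normO normTheta Cstb n.
have [oO _ _ bO _] := hOmega.
have dis : forall i j, i != j -> K i `&` K j = set0 by case: hK.
have ipuP := ip_semi_inner k oO bO hK hMu.
have ipvP := ip_semi_inner k oO bO hK hMv.
have ipu0 := ip_definite (k := k) oO bO hK hMu.
have chi_sym := @ip_chi R d N mv k Omega K Mv dis.
have chi_ge0 := @ip_chi_ge0 R d N mv k Omega K Mv dis ipvP.
move: htau; rewrite le_min => /andP[tau_m tau_lf].
exact: (@local_scheme_stability R (Vh R d N mu k) (Vh R d N mv k)
  (ip Omega K Mu) (ip Omega K Mv) Lu Lv (chi (mesh_m K Tf)) (chi (mesh_lf K Tf))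
  ThetaT Psi cTheta vartheta tau betaPsi ipuP ipu0 ipvP hL (chi_sym _)
  (chi_ge0 _) (chi_sym _) (chi_ge0 _) (chiC (mesh_m K Tf)) hcTheta hbeta hvartheta htau0 tau_m
  tau_lf hThetaT x g n hx).
Qed.
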